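(* Let $\psi$ be a unit speed spacelike curve in $E_1^3$ with arclength parameter $s$, nowhere-zero curvature $\kappa$, and timelike principal normal vector, which is a general helix whose tangent vector makes a constant Lorentzian spacelike angle $\phi$ with a fixed spacelike straight line (the axis). Put $n=\cos\phi$ and $m=\frac{n}{\sqrt{1-n^2}}$. Then, up to an isometry of $E_1^3$ carrying the axis to the direction of $\mathbf{e}_3=(0,0,1)$, and for a suitable choice of the constants of integration, the position vector of $\psi$ is given in natural representation by $$\psi(s)=\sqrt{1-n^2}\int\Big(\sinh\Big[\sqrt{1+m^2}\int\kappa(s)\,ds\Big],\ \cosh\Big[\sqrt{1+m^2}\int\kappa(s)\,ds\Big],\ m\Big)ds,$$ or, in parametric form with $\theta=\int\kappa(s)\,ds$, $$\psi(\theta)=\int\frac{\sqrt{1-n^2}}{\kappa(\theta)}\Big(\sinh[\sqrt{1+m^2}\,\theta],\ \cosh[\sqrt{1+m^2}\,\theta],\ m\Big)d\theta.$$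
   Context: $E_1^3$ is $\mathbb{R}^3$ with the Lorentzian metric $g=-dx_1^2+dx_2^2+dx_3^2$ and $\|a\|=\sqrt{|g(a,a)|}$. A vector $v$ is spacelike if $g(v,v)>0$ or $v=0$, timelike if $g(v,v)<0$, and null if $g(v,v)=0$ and $v\neq0$. A curve is spacelike if all its velocity vectors are spacelike. All curves are smooth. For a unit speed spacelike curve with spacelike or timelike principal normal $N$, the Frenet frame $\{T=\psi',N,B\}$, curvature $\kappa$ and torsion $\tau$ satisfy $T'=\kappa N$, $N'=-\varepsilon\kappa T+\tau B$, $B'=\tau N$, where $g(T,T)=1$, $g(N,N)=\varepsilon=\pm1$, $g(B,B)=-\varepsilon$, and $T,N,B$ are mutually orthogonal (so $\varepsilon=-1$ when $N$ is timelike). A general helix is a curve whose tangent lines make a constant angle with a fixed direction. If $X,Y$ are spacelike vectors spanning a spacelike plane, the Lorentzian spacelike angle between them is the positive real number $\phi$ with $|g(X,Y)|=\|X\|\,\|Y\|\cos\phi$. The angle between $T$ and a line is the angle between $T$ and a direction vector of the line; thus here $0\le n<1$ and $|g(T,\mathbf{d})|=n$ along the curve for a unit direction vector $\mathbf{d}$ of the axis. *)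

(* Defs.v *)
From Stdlib Require Import Reals.
From Coquelicot Require Import Coquelicot.
Open Scope R_scope.

Notation E13 := (R * R * R)%type.

Definition g (u v : E13) : R :=
  let '(u1, u2, u3) := u in
  let '(v1, v2, v3) := v in
  - (u1 * v1) + u2 * v2 + u3 * v3.

(* Not Coquelicot's [norm], which is the product norm used for limits. *)
Definition lnorm (a : E13) : R := sqrt (Rabs (g a a)).

Definition spacelike (v : E13) : Prop := g v v > 0 \/ v = zero.
Definition timelike (v : E13) : Prop := g v v < 0.

Definition spans_spacelike_plane (X Y : E13) : Prop :=
  (forall a b : R, plus (scal a X) (scal b Y) = zero -> a = 0 /\ b = 0) /\
  (forall a b : R, spacelike (plus (scal a X) (scal b Y))).

(* The equation determines [phi] only through [cos phi], which it forces to be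
   nonnegative; no representative such as the one in (0, PI/2] is singled out. *)
Definition spacelike_angle (X Y : E13) (phi : R) : Prop :=
  spacelike X /\ spacelike Y /\ spans_spacelike_plane X Y /\
  0 < phi /\ Rabs (g X Y) = lnorm X * lnorm Y * cos phi.

Definition line (p d : E13) (q : E13) : Prop :=
  exists t : R, q = plus p (scal t d).

Definition e3 : E13 := (0, 0, 1).

(* Improper and time-reversing maps are included. *)
Definition lorentz_isometry (F : E13 -> E13) : Prop :=
  exists (L : E13 -> E13) (b : E13),
    is_linear L /\
    (forall u v, g (L u) (L v) = g u v) /\
    (forall x, F x = plus (L x) b).

Definition open_itv (a b : Rbar) (s : R) : Prop := Rbar_lt a s /\ Rbar_lt s b.

Definition smooth (I : R -> Prop) (psi : R -> E13) : Prop :=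
  forall (k : nat) (s : R), I s ->
    ex_derive_n (fun t => fst (fst (psi t))) k s /\
    ex_derive_n (fun t => snd (fst (psi t))) k s /\
    ex_derive_n (fun t => snd (psi t)) k s.

(* [frenet_gTT] says that [psi] is spacelike and of unit speed.  The sign of
   [kappa] is left free: replacing (kappa, N) by (-kappa, -N) and tau by -tau
   gives again a Frenet frame. *)
Record frenet_frame (I : R -> Prop) (psi T N B : R -> E13) (eps : R)
    (kappa tau : R -> R) : Prop := {
  frenet_eps : eps = 1 \/ eps = -1;
  frenet_T : forall s, I s -> is_derive psi s (T s);
  frenet_dT : forall s, I s -> is_derive T s (scal (kappa s) (N s));
  frenet_dN : forall s, I s ->
    is_derive N s (plus (scal (- eps * kappa s) (T s)) (scal (tau s) (B s)));
  frenet_dB : forall s, I s -> is_derive B s (scal (tau s) (N s));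
  frenet_gTT : forall s, I s -> g (T s) (T s) = 1;
  frenet_gNN : forall s, I s -> g (N s) (N s) = eps;
  frenet_gBB : forall s, I s -> g (B s) (B s) = - eps;
  frenet_gTN : forall s, I s -> g (T s) (N s) = 0;
  frenet_gTB : forall s, I s -> g (T s) (B s) = 0;
  frenet_gNB : forall s, I s -> g (N s) (B s) = 0
}.

(* [G] is one of the functions denoted by the indefinite integral of [f] on
   [I]; the constant of integration is part of [G]. *)
Definition indefinite_integral {V : NormedModule R_AbsRing}
    (I : R -> Prop) (f G : R -> V) : Prop :=
  forall a b, I a -> I b -> is_RInt f a b (minus (G b) (G a)).

Definition hyperbolic_dir (m u : R) : E13 :=
  (sinh (sqrt (1 + m ^ 2) * u), cosh (sqrt (1 + m ^ 2) * u), m).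

(* Main.v *)
Require Import Defs.
From Stdlib Require Import Reals.
From Coquelicot Require Import Coquelicot.
From Stdlib Require Import Lra ClassicalEpsilon.
Open Scope R_scope.

(** Let [D] be a unit vector along the axis, oriented so that [g T D = n], and
    put [r = sqrt (1 - n ^ 2)].  The angle condition prescribes only the absolute
    value of [g T D], but a continuous function with constant absolute value is
    constant.  The spacelike plane spanned by [T] and [d] forces [n < 1], so
    [r > 0].

    Differentiating [g T D = n] twice with the Frenet equations gives first
    [g N D = 0] and then [kappa * n + tau * g B D = 0], while [D] being a unit
    vector gives [(g B D) ^ 2 = r ^ 2].  Hence the torsion can be eliminated
    (lemma [axis_coordinates]), and the component [P = T - n D] of the tangent
    satisfies
      [P' = kappa N] and [N' = (kappa / r ^ 2) P].
    In the variable [theta], the primitive of [kappa] vanishing at a base point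
    [s0], this is a linear system with constant coefficients whose solutions are
    combinations of [cosh (theta / r)] and [sinh (theta / r)] (lemmas
    [hyperbolic_oscillator] and [tangent_solution]).

    The vectors [N s0], [P s0 / r], [D] are orthonormal, and taking coordinates in
    this frame is an isometry that carries the axis to the direction of [e3].
    With these initial values the coordinates of [T] are exactly
    [r * (sinh (theta / r), cosh (theta / r), n / r)], and
    [1 / r = sqrt (1 + m ^ 2)] (lemma [tangent_in_axis_frame]).  Reading the frame
    off the curve at [s0] settles every choice of sign, so no reflection has to
    be selected afterwards.

    Integrating in [s] gives the natural representation.  The parametric form
    is the substitution [u = theta s], which needs a continuous inverse of [theta];
    it exists because [theta] has a continuous derivative without zeros.  That
    [kappa] is continuous follows from the smoothness of the curve, since
    [kappa = - g T' N] (lemma [curvature_continuous]). *)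

(** * Linear algebra of the Lorentzian form *)

Ltac E13_unfold :=
  repeat progress
    (unfold g, minus, plus, opp, scal, zero, mult,
       prod_plus, prod_opp, prod_scal, prod_zero in *; cbn in *).

Lemma E13_eq (x1 x2 x3 y1 y2 y3 : R) :
  x1 = y1 -> x2 = y2 -> x3 = y3 -> (x1, x2, x3) = (y1, y2, y3).
Proof. intros; subst; reflexivity. Qed.

Lemma E13_scal_scal (h k : R) (v : E13) : scal h (scal k v) = scal (h * k) v.
Proof. destruct v as [[? ?] ?]; apply E13_eq; E13_unfold; ring. Qed.

Lemma E13_scal_1 (v : E13) : scal 1 v = v.
Proof. destruct v as [[? ?] ?]; apply E13_eq; E13_unfold; ring. Qed.

Lemma is_linear_E13_scal (k : R) : is_linear (fun u : E13 => scal k u).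
Proof.
exact (is_linear_scal_r (V := prod_NormedModule _
  (prod_NormedModule _ R_NormedModule R_NormedModule) R_NormedModule) k Rmult_comm).
Qed.

Lemma continuous_E13_scal (f : R -> R) (X : R -> E13) (u : R) :
  continuous f u -> continuous X u -> continuous (fun t => scal (f t) (X t)) u.
Proof.
exact (continuous_scal (V := prod_NormedModule _
  (prod_NormedModule _ R_NormedModule R_NormedModule) R_NormedModule) f X u).
Qed.

Lemma g_sym (u v : E13) : g u v = g v u.
Proof. destruct u as [[? ?] ?], v as [[? ?] ?]; E13_unfold; ring. Qed.

Lemma g_plus_l (u v w : E13) : g (plus u v) w = g u w + g v w.
Proof.
destruct u as [[? ?] ?], v as [[? ?] ?], w as [[? ?] ?]; E13_unfold; ring.
Qed.

Lemma g_scal_l (k : R) (u v : E13) : g (scal k u) v = k * g u v.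
Proof. destruct u as [[? ?] ?], v as [[? ?] ?]; E13_unfold; ring. Qed.

Lemma g_plus_r (u v w : E13) : g w (plus u v) = g w u + g w v.
Proof. rewrite g_sym, g_plus_l, (g_sym u), (g_sym v); reflexivity. Qed.

Lemma g_scal_r (k : R) (u v : E13) : g v (scal k u) = k * g v u.
Proof. rewrite g_sym, g_scal_l, (g_sym u); reflexivity. Qed.

Lemma is_linear_g (v : E13) : is_linear (fun u : E13 => g u v).
Proof.
destruct v as [[v1 v2] v3].
apply (is_linear_ext (fun u : E13 =>
  plus (scal (- v1) (fst (fst u)))
       (plus (scal v2 (snd (fst u))) (scal v3 (snd u))))).
{ intros [[u1 u2] u3]; E13_unfold; ring. }
assert (scal_comp : forall (k : R) (l : E13 -> R),
          is_linear l -> is_linear (fun u => scal k (l u))).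
{ intros k l hl.
  apply (is_linear_comp l (fun y : R => scal k y)); [exact hl |].
  apply (is_linear_scal_r (V := R_NormedModule) k Rmult_comm). }
assert (plus_comp : forall l1 l2 : E13 -> R, is_linear l1 -> is_linear l2 ->
          is_linear (fun u => plus (l1 u) (l2 u))).
{ intros l1 l2 h1 h2.
  apply (is_linear_comp (fun u => (l1 u, l2 u)) (fun y => plus (fst y) (snd y))).
  - apply is_linear_prod; assumption.
  - apply is_linear_plus. }
repeat apply plus_comp; apply scal_comp.
- apply (is_linear_comp fst fst); apply is_linear_fst.
- apply (is_linear_comp fst snd); [apply is_linear_fst | apply is_linear_snd].
- apply is_linear_snd.
Qed.

Definition lorentz_orthonormal (E1 E2 E3 : E13) : Prop :=
  g E1 E1 = -1 /\ g E2 E2 = 1 /\ g E3 E3 = 1 /\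
  g E1 E2 = 0 /\ g E1 E3 = 0 /\ g E2 E3 = 0.

Lemma lorentz_orthonormal_nondegenerate (E1 E2 E3 w : E13) :
  lorentz_orthonormal E1 E2 E3 ->
  g w E1 = 0 -> g w E2 = 0 -> g w E3 = 0 -> w = zero.
Proof.
destruct E1 as [[a1 a2] a3], E2 as [[b1 b2] b3], E3 as [[c1 c2] c3],
  w as [[w1 w2] w3].
intros (haa & hbb & hcc & hab & hac & hbc) ha hb hc; E13_unfold.
set (D := a1 * (b2 * c3 - b3 * c2) - a2 * (b1 * c3 - b3 * c1)
          + a3 * (b1 * c2 - b2 * c1)).
(* The Gram determinant of the three vectors is minus the square of their
   determinant. *)
assert (hD : D * D = 1).
{ replace (D * D) with
    (- ((- (a1 * a1) + a2 * a2 + a3 * a3) *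
        ((- (b1 * b1) + b2 * b2 + b3 * b3) * (- (c1 * c1) + c2 * c2 + c3 * c3)
         - (- (b1 * c1) + b2 * c2 + b3 * c3) * (- (b1 * c1) + b2 * c2 + b3 * c3))
        - (- (a1 * b1) + a2 * b2 + a3 * b3) *
        ((- (a1 * b1) + a2 * b2 + a3 * b3) * (- (c1 * c1) + c2 * c2 + c3 * c3)
         - (- (b1 * c1) + b2 * c2 + b3 * c3) * (- (a1 * c1) + a2 * c2 + a3 * c3))
        + (- (a1 * c1) + a2 * c2 + a3 * c3) *
        ((- (a1 * b1) + a2 * b2 + a3 * b3) * (- (b1 * c1) + b2 * c2 + b3 * c3)
         - (- (b1 * b1) + b2 * b2 + b3 * b3) * (- (a1 * c1) + a2 * c2 + a3 * c3))))
    by (unfold D; ring).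
  rewrite haa, hbb, hcc, hab, hac, hbc; ring. }
assert (hD0 : D <> 0) by (intros h; rewrite h in hD; lra).
(* Cramer's rule for the linear system saying that w is orthogonal to the
   three vectors. *)
assert (hw1 : D * w1 = 0).
{ replace (D * w1) with
    (- ((- (w1 * a1) + w2 * a2 + w3 * a3) * (b2 * c3 - b3 * c2)
      - (- (w1 * b1) + w2 * b2 + w3 * b3) * (a2 * c3 - a3 * c2)
      + (- (w1 * c1) + w2 * c2 + w3 * c3) * (a2 * b3 - a3 * b2)))
    by (unfold D; ring).
  rewrite ha, hb, hc; ring. }
assert (hw2 : D * w2 = 0).
{ replace (D * w2) with
    (- ((- (w1 * a1) + w2 * a2 + w3 * a3) * (b1 * c3 - b3 * c1)
      - (- (w1 * b1) + w2 * b2 + w3 * b3) * (a1 * c3 - a3 * c1)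
      + (- (w1 * c1) + w2 * c2 + w3 * c3) * (a1 * b3 - a3 * b1)))
    by (unfold D; ring).
  rewrite ha, hb, hc; ring. }
assert (hw3 : D * w3 = 0).
{ replace (D * w3) with
    ((- (w1 * a1) + w2 * a2 + w3 * a3) * (b1 * c2 - b2 * c1)
      - (- (w1 * b1) + w2 * b2 + w3 * b3) * (a1 * c2 - a2 * c1)
      + (- (w1 * c1) + w2 * c2 + w3 * c3) * (a1 * b2 - a2 * b1))
    by (unfold D; ring).
  rewrite ha, hb, hc; ring. }
apply Rmult_integral in hw1, hw2, hw3.
apply E13_eq; tauto.
Qed.

(** The difference of the two sides is orthogonal to the whole frame. *)
Lemma lorentz_orthonormal_expansion (E1 E2 E3 v : E13) :
  lorentz_orthonormal E1 E2 E3 ->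
  v = plus (scal (- g v E1) E1) (plus (scal (g v E2) E2) (scal (g v E3) E3)).
Proof.
intros h; generalize h; intros (h11 & h22 & h33 & h12 & h13 & h23).
set (w := plus (scal (- g v E1) E1) (plus (scal (g v E2) E2) (scal (g v E3) E3))).
assert (hz : plus v (scal (-1) w) = zero).
{ apply (lorentz_orthonormal_nondegenerate E1 E2 E3 _ h); unfold w;
    repeat rewrite ?g_plus_l, ?g_scal_l;
    rewrite ?(g_sym E2 E1), ?(g_sym E3 E1), ?(g_sym E3 E2),
      ?h11, ?h22, ?h33, ?h12, ?h13, ?h23; ring. }
clearbody w; clear - hz.
destruct v as [[v1 v2] v3], w as [[w1 w2] w3].
E13_unfold; injection hz; intros; apply E13_eq; lra.
Qed.

(** The first coordinate carries a minus sign because [E1] is timelike. *)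
Definition frame_coords (E1 E2 E3 v : E13) : E13 := (- g v E1, g v E2, g v E3).

Lemma is_linear_frame_coords (E1 E2 E3 : E13) :
  is_linear (frame_coords E1 E2 E3).
Proof.
unfold frame_coords.
apply (is_linear_prod (fun v => (- g v E1, g v E2)) (fun v => g v E3)).
- apply (is_linear_prod (fun v => - g v E1) (fun v => g v E2)).
  + apply (is_linear_comp (fun v => g v E1) opp).
    * apply is_linear_g.
    * apply is_linear_opp.
  + apply is_linear_g.
- apply is_linear_g.
Qed.

Lemma frame_coords_isometry (E1 E2 E3 u v : E13) :
  lorentz_orthonormal E1 E2 E3 ->
  g (frame_coords E1 E2 E3 u) (frame_coords E1 E2 E3 v) = g u v.
Proof.
intros h.
transitivity (g (plus (scal (- g u E1) E1)
                   (plus (scal (g u E2) E2) (scal (g u E3) E3))) v).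
- rewrite !g_plus_l, !g_scal_l, (g_sym E1), (g_sym E2), (g_sym E3).
  unfold frame_coords, g at 1; ring.
- rewrite <- (lorentz_orthonormal_expansion E1 E2 E3 u h); reflexivity.
Qed.

Lemma frame_coords_inj (E1 E2 E3 u v : E13) :
  lorentz_orthonormal E1 E2 E3 ->
  frame_coords E1 E2 E3 u = frame_coords E1 E2 E3 v -> u = v.
Proof.
intros h e; injection e; intros e3 e2 e1.
rewrite (lorentz_orthonormal_expansion E1 E2 E3 u h),
  (lorentz_orthonormal_expansion E1 E2 E3 v h).
rewrite e3, e2, e1; reflexivity.
Qed.

Lemma frame_coords_third (E1 E2 E3 : E13) :
  lorentz_orthonormal E1 E2 E3 -> frame_coords E1 E2 E3 E3 = e3.
Proof.
intros (h11 & h22 & h33 & h12 & h13 & h23).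
unfold frame_coords, e3.
rewrite (g_sym E3 E1), (g_sym E3 E2), h33, h13, h23.
apply E13_eq; ring.
Qed.

Lemma frame_coords_line (E1 E2 E3 p d q : E13) (k : R) :
  lorentz_orthonormal E1 E2 E3 -> k <> 0 -> E3 = scal k d ->
  line p d q <->
  line (frame_coords E1 E2 E3 p) e3 (frame_coords E1 E2 E3 q).
Proof.
intros h hk hE3.
assert (hlin := is_linear_frame_coords E1 E2 E3).
assert (hL : forall t, plus (frame_coords E1 E2 E3 p) (scal (t / k) e3)
                       = frame_coords E1 E2 E3 (plus p (scal t d))).
{ intros t.
  assert (he3 : e3 = scal k (frame_coords E1 E2 E3 d))
    by (rewrite <- (frame_coords_third E1 E2 E3 h);
        exact (eq_trans (f_equal _ hE3) (linear_scal _ hlin k d))).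
  rewrite he3, (linear_plus _ hlin), (linear_scal _ hlin), scal_assoc.
  f_equal; f_equal; unfold mult; cbn; field; exact hk. }
split.
- intros [t ->]; exists (t / k); symmetry; apply hL.
- intros [t ht]; exists (t * k).
  apply (frame_coords_inj E1 E2 E3); [exact h |].
  rewrite ht, <- hL; f_equal; f_equal; field; exact hk.
Qed.

(** * Calculus on an open interval *)

Lemma open_open_itv (a b : Rbar) : open (open_itv a b).
Proof. apply open_and; [apply open_Rbar_gt | apply open_Rbar_lt]. Qed.

Lemma open_itv_between (a b : Rbar) (x y z : R) :
  open_itv a b x -> open_itv a b y -> Rmin x y <= z <= Rmax x y ->
  open_itv a b z.
Proof.
intros [hx1 hx2] [hy1 hy2] [h1 h2].
split.
- apply Rbar_lt_le_trans with (Rmin x y); [| exact h1].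
  unfold Rmin; destruct Rle_dec; assumption.
- apply Rbar_le_lt_trans with (Rmax x y); [exact h2 |].
  unfold Rmax; destruct Rle_dec; assumption.
Qed.

Lemma open_itv_nonempty (a b : Rbar) :
  Rbar_lt a b -> exists s, open_itv a b s.
Proof.
unfold open_itv; destruct a as [a | |], b as [b | |]; cbn; try easy; intros h.
- exists ((a + b) / 2); cbn; lra.
- exists (a + 1); cbn; lra.
- exists (b - 1); cbn; lra.
- exists 0; cbn; tauto.
Qed.

Lemma is_derive_linear_comp {U V : NormedModule R_AbsRing}
    (l : U -> V) (f : R -> U) (s : R) (df : U) :
  is_linear l -> is_derive f s df -> is_derive (fun t => l (f t)) s (l df).
Proof.
intros hl hf.
apply filterdiff_ext_lin with (fun y : R => l (scal y df)).
- apply (filterdiff_comp' f l); [exact hf | apply filterdiff_linear; exact hl].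
- intros y; exact (linear_scal l hl y df).
Qed.

Lemma is_derive_continuous {V : NormedModule R_AbsRing} (f : R -> V) (s : R) (df : V) :
  is_derive f s df -> continuous f s.
Proof. intros h; apply ex_derive_continuous; exists df; exact h. Qed.

Lemma mvt_open_itv (a b : Rbar) (f df : R -> R) (x y : R) :
  (forall s, open_itv a b s -> is_derive f s (df s)) ->
  open_itv a b x -> open_itv a b y ->
  exists c, open_itv a b c /\ f y - f x = df c * (y - x).
Proof.
intros hf hx hy.
destruct (MVT_gen f x y df) as (c & hc & e).
- intros s hs; apply hf, (open_itv_between a b x y); [assumption .. | lra].
- intros s hs; apply continuity_pt_filterlim.
  apply (is_derive_continuous f s (df s)), hf.
  apply (open_itv_between a b x y); assumption.
- exists c; split; [apply (open_itv_between a b x y); assumption | exact e].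
Qed.

Lemma derive_zero_constant (a b : Rbar) (f : R -> R) (x y : R) :
  (forall s, open_itv a b s -> is_derive f s 0) ->
  open_itv a b x -> open_itv a b y -> f y = f x.
Proof.
intros hf hx hy.
destruct (mvt_open_itv a b f (fun _ => 0) x y hf hx hy) as (c & _ & e); lra.
Qed.

Lemma ivt_open_itv (a b : Rbar) (f : R -> R) (x1 x2 y : R) :
  (forall s, open_itv a b s -> continuous f s) ->
  open_itv a b x1 -> open_itv a b x2 ->
  Rmin (f x1) (f x2) <= y <= Rmax (f x1) (f x2) ->
  exists x, Rmin x1 x2 <= x <= Rmax x1 x2 /\ f x = y.
Proof.
intros hf.
assert (increasing : forall (h : R -> R) (u v z : R),
          (forall s, open_itv a b s -> continuous h s) ->
          open_itv a b u -> open_itv a b v -> u <= v -> h u <= z <= h v ->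
          exists x, u <= x <= v /\ h x = z).
{ intros h u v z hh hu hv huv hz.
  destruct (Rle_lt_or_eq_dec u v huv) as [huv' | <-].
  - destruct (Ranalysis5.f_interv_is_interv h u v z huv' hz) as (x & hx & e).
    + intros s hs; apply continuity_pt_filterlim, hh.
      apply (open_itv_between a b u v); [assumption .. |].
      rewrite Rmin_left, Rmax_right; lra.
    + exists x; tauto.
  - exists u; split; lra. }
assert (ordered : forall u v : R, open_itv a b u -> open_itv a b v -> u <= v ->
          Rmin (f u) (f v) <= y <= Rmax (f u) (f v) ->
          exists x, u <= x <= v /\ f x = y).
{ intros u v hu hv huv hy.
  destruct (Rle_dec (f u) (f v)) as [h | h].
  - rewrite Rmin_left, Rmax_right in hy by lra.
    apply increasing; assumption.
  - rewrite Rmin_right, Rmax_left in hy by lra.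
    destruct (increasing (fun s => - f s) u v (- y)) as (x & hx & e);
      [| assumption .. | lra |].
    + intros s hs; apply (continuous_opp f), hf, hs.
    + exists x; split; [assumption | lra]. }
intros h1 h2 hy.
destruct (Rle_dec x1 x2) as [h | h].
- rewrite (Rmin_left x1), (Rmax_right x1) by lra.
  apply ordered; assumption.
- rewrite (Rmin_right x1), (Rmax_left x1) by lra.
  apply ordered; [assumption .. | lra |].
  rewrite Rmin_comm, Rmax_comm; assumption.
Qed.

Lemma nonvanishing_same_sign (a b : Rbar) (f : R -> R) (x y : R) :
  (forall s, open_itv a b s -> continuous f s) ->
  (forall s, open_itv a b s -> f s <> 0) ->
  open_itv a b x -> open_itv a b y -> 0 < f x * f y.
Proof.
intros hf h0 hx hy.
destruct (Rlt_dec 0 (f x * f y)) as [h | h]; [exact h | exfalso].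
destruct (ivt_open_itv a b f x y 0 hf hx hy) as (z & hz & e).
- unfold Rmin, Rmax; destruct Rle_dec; nra.
- apply (h0 z); [| exact e].
  apply (open_itv_between a b x y); assumption.
Qed.

Lemma primitive_exists (a b : Rbar) (f : R -> R) (s0 : R) :
  (forall s, open_itv a b s -> continuous f s) -> open_itv a b s0 ->
  exists F : R -> R,
    F s0 = 0 /\ forall s, open_itv a b s -> is_derive F s (f s).
Proof.
intros hf h0.
exists (fun s => RInt f s0 s); split.
- apply (RInt_point s0 f).
- intros s hs.
  apply (is_derive_RInt f (fun t => RInt f s0 t) s0); [| apply hf, hs].
  apply (locally_open (open_itv a b)); [apply open_open_itv | | exact hs].
  intros t ht; apply (RInt_correct f), (ex_RInt_continuous f).
  intros z hz; apply hf, (open_itv_between a b s0 t); assumption.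
Qed.

Lemma indefinite_integral_of_derive (a b : Rbar) (f F : R -> R) :
  (forall s, open_itv a b s -> is_derive F s (f s)) ->
  (forall s, open_itv a b s -> continuous f s) ->
  indefinite_integral (open_itv a b) f F.
Proof.
intros hF hf x y hx hy.
apply (is_RInt_derive F f); intros z hz;
  [apply hF | apply hf]; apply (open_itv_between a b x y); assumption.
Qed.

Lemma indefinite_integral_E13 (I : R -> Prop) (f G : R -> E13) :
  indefinite_integral I (fun s => fst (fst (f s))) (fun s => fst (fst (G s))) ->
  indefinite_integral I (fun s => snd (fst (f s))) (fun s => snd (fst (G s))) ->
  indefinite_integral I (fun s => snd (f s)) (fun s => snd (G s)) ->
  indefinite_integral I f G.
Proof.
intros h1 h2 h3 x y hx hy.
specialize (h1 x y hx hy); specialize (h2 x y hx hy); specialize (h3 x y hx hy).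
revert h1 h2 h3; cbv beta.
destruct (G x) as [[? ?] ?], (G y) as [[? ?] ?]; intros h1 h2 h3.
apply (is_RInt_fct_extend_pair f); [| exact h3].
apply (is_RInt_fct_extend_pair (fun s => fst (f s))); [exact h1 | exact h2].
Qed.

Lemma indefinite_integral_of_derive_E13 (a b : Rbar) (f F : R -> E13) :
  (forall s, open_itv a b s -> is_derive F s (f s)) ->
  (forall s, open_itv a b s -> continuous f s) ->
  indefinite_integral (open_itv a b) f F.
Proof.
intros hF hf.
assert (component : forall l : E13 -> R, is_linear l ->
          indefinite_integral (open_itv a b) (fun s => l (f s)) (fun s => l (F s))).
{ intros l hl; apply indefinite_integral_of_derive; intros s hs.
  - apply is_derive_linear_comp; [exact hl | apply hF, hs].
  - apply (continuous_comp f l); [apply hf, hs | exact (linear_cont l (f s) hl)]. }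
apply indefinite_integral_E13.
- apply (component (fun u => fst (fst u))).
  apply (is_linear_comp fst fst); apply is_linear_fst.
- apply (component (fun u => snd (fst u))).
  apply (is_linear_comp fst snd); [apply is_linear_fst | apply is_linear_snd].
- apply (component snd), is_linear_snd.
Qed.

(** * Change of variable *)

Lemma nonzero_derive_inj (a b : Rbar) (theta kappa : R -> R) (x y : R) :
  (forall s, open_itv a b s -> is_derive theta s (kappa s)) ->
  (forall s, open_itv a b s -> kappa s <> 0) ->
  open_itv a b x -> open_itv a b y -> theta x = theta y -> x = y.
Proof.
intros ht h0 hx hy e.
destruct (mvt_open_itv a b theta kappa x y ht hx hy) as (c & hc & e').
assert (hz : kappa c * (y - x) = 0) by lra.
apply Rmult_integral in hz; destruct hz as [hz | hz]; [| lra].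
exfalso; exact (h0 c hc hz).
Qed.

Lemma left_inverse_exists (I : R -> Prop) (theta : R -> R) :
  (forall x y, I x -> I y -> theta x = theta y -> x = y) ->
  exists sigma : R -> R, forall s, I s -> sigma (theta s) = s.
Proof.
intros hinj.
exists (fun u => epsilon (inhabits 0) (fun s => I s /\ theta s = u)).
intros s hs.
destruct (epsilon_spec (inhabits 0) (fun t => I t /\ theta t = theta s))
  as [h e]; [exists s; tauto |].
apply hinj; assumption.
Qed.

(** After multiplication by the constant [kappa s], the function [theta] is
    strictly increasing, so that values near [theta s] lie between the values at
    [s - delta] and at [s + delta] and are therefore taken between these points. *)
Lemma left_inverse_continuous (a b : Rbar) (theta kappa sigma : R -> R) (s : R) :
  (forall s, open_itv a b s -> is_derive theta s (kappa s)) ->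
  (forall s, open_itv a b s -> continuous kappa s) ->
  (forall s, open_itv a b s -> kappa s <> 0) ->
  (forall s, open_itv a b s -> sigma (theta s) = s) ->
  open_itv a b s -> continuous sigma (theta s).
Proof.
intros ht hk h0 hsigma hs.
assert (hmono : forall x y, open_itv a b x -> open_itv a b y -> x < y ->
          kappa s * theta x < kappa s * theta y).
{ intros x y hx hy hxy.
  destruct (mvt_open_itv a b theta kappa x y ht hx hy) as (c & hc & e).
  assert (hsc := nonvanishing_same_sign a b kappa s c hk h0 hs hc).
  assert (e' : kappa s * theta y - kappa s * theta x
               = (kappa s * kappa c) * (y - x))
    by (rewrite <- Rmult_minus_distr_l, e; ring).
  assert (0 < (kappa s * kappa c) * (y - x)) by (apply Rmult_lt_0_compat; lra).
  lra. }
destruct (open_open_itv a b s hs) as [r hr].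
unfold continuous; rewrite (hsigma s hs).
apply filterlim_locally; intros eps.
set (delta := Rmin (r / 2) (eps / 2)).
assert (hdelta : 0 < delta)
  by (unfold delta; apply Rmin_pos; [destruct r | destruct eps]; cbn; lra).
assert (hdr : delta < r)
  by (apply Rle_lt_trans with (r / 2); [apply Rmin_l | destruct r; cbn; lra]).
assert (hde : delta < eps)
  by (apply Rle_lt_trans with (eps / 2); [apply Rmin_r | destruct eps; cbn; lra]).
assert (hI : forall x, Rabs (x - s) <= delta -> open_itv a b x).
{ intros x hx; apply hr; apply Rle_lt_trans with delta; assumption. }
assert (hl : open_itv a b (s - delta))
  by (apply hI; rewrite Rabs_left; lra).
assert (hu : open_itv a b (s + delta))
  by (apply hI; rewrite Rabs_right; lra).
assert (hlow := hmono (s - delta) s hl hs ltac:(lra)).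
assert (hupp := hmono s (s + delta) hs hu ltac:(lra)).
assert (hnear : locally (theta s) (fun u =>
          kappa s * theta (s - delta) < kappa s * u < kappa s * theta (s + delta))).
{ assert (hc : continuous (fun u => kappa s * u) (theta s))
    by (apply (continuous_mult (fun _ => kappa s) (fun u => u));
        [apply continuous_const | apply continuous_id]).
  apply (hc (fun v => kappa s * theta (s - delta) < v < kappa s * theta (s + delta))).
  apply (locally_open (fun v => kappa s * theta (s - delta) < v
                                < kappa s * theta (s + delta))
    (fun v => kappa s * theta (s - delta) < v < kappa s * theta (s + delta)));
    [| tauto | split; assumption].
  apply open_and; [apply open_gt | apply open_lt]. }
revert hnear; apply filter_imp; intros u hku.
destruct (ivt_open_itv a b (fun x => kappa s * theta x) (s - delta) (s + delta)
            (kappa s * u)) as (x & hx & e).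
- intros t hti; apply (continuous_mult (fun _ => kappa s) theta).
  + apply continuous_const.
  + apply (is_derive_continuous theta t (kappa t)), ht, hti.
- exact hl.
- exact hu.
- rewrite Rmin_left, Rmax_right; lra.
- rewrite Rmin_left, Rmax_right in hx by lra.
  apply Rmult_eq_reg_l in e; [| apply h0, hs].
  rewrite <- e, hsigma by (apply hI, Rabs_le; lra).
  apply Rle_lt_trans with delta; [apply Rabs_le | exact hde].
  unfold minus, plus, opp; cbn; lra.
Qed.

Lemma indefinite_integral_substitution {V : CompleteNormedModule R_AbsRing}
    (a b : Rbar) (theta kappa sigma : R -> R) (f H : R -> V) :
  (forall s, open_itv a b s -> is_derive theta s (kappa s)) ->
  (forall s, open_itv a b s -> continuous kappa s) ->
  (forall s, open_itv a b s -> sigma (theta s) = s) ->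
  (forall s, open_itv a b s -> continuous f (theta s)) ->
  indefinite_integral (open_itv a b)
    (fun s => scal (kappa s) (f (theta s))) H ->
  indefinite_integral (fun u => exists s, open_itv a b s /\ theta s = u)
    f (fun u => H (sigma u)).
Proof.
intros ht hk hsigma hf hH u1 u2 (s1 & h1 & <-) (s2 & h2 & <-).
rewrite (hsigma s1 h1), (hsigma s2 h2).
assert (hbetween : forall s, Rmin s1 s2 <= s <= Rmax s1 s2 -> open_itv a b s)
  by (intros s; apply open_itv_between; assumption).
rewrite <- (is_RInt_unique _ _ _ _ (hH s1 s2 h1 h2)).
rewrite (is_RInt_unique (fun s => scal (kappa s) (f (theta s))) s1 s2
           (RInt f (theta s1) (theta s2))).
- apply (RInt_correct f), (ex_RInt_continuous f); intros u hu.
  destruct (ivt_open_itv a b theta s1 s2 u) as (s & hs & <-);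
    [| assumption .. |].
  + intros s hs; apply (is_derive_continuous theta s (kappa s)), ht, hs.
  + apply hf, hbetween, hs.
- apply (is_RInt_comp f theta kappa s1 s2); intros s hs.
  + apply hf, hbetween, hs.
  + split; [apply ht | apply hk]; apply hbetween, hs.
Qed.

Lemma indefinite_integral_substitution_E13
    (a b : Rbar) (theta kappa sigma : R -> R) (f H : R -> E13) :
  (forall s, open_itv a b s -> is_derive theta s (kappa s)) ->
  (forall s, open_itv a b s -> continuous kappa s) ->
  (forall s, open_itv a b s -> sigma (theta s) = s) ->
  (forall s, open_itv a b s -> continuous f (theta s)) ->
  indefinite_integral (open_itv a b)
    (fun s => scal (kappa s) (f (theta s))) H ->
  indefinite_integral (fun u => exists s, open_itv a b s /\ theta s = u)
    f (fun u => H (sigma u)).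
Proof.
intros ht hk hsigma hf hH.
apply indefinite_integral_E13.
- apply (indefinite_integral_substitution a b theta kappa sigma
           (fun u => fst (fst (f u))) (fun s => fst (fst (H s))));
    [assumption .. | |].
  + intros s hs; apply (continuous_comp f (fun v : E13 => fst (fst v)));
      [apply hf, hs |].
    apply (linear_cont (fun v : E13 => fst (fst v))).
    apply (is_linear_comp fst fst); apply is_linear_fst.
  + intros x y hx hy; specialize (hH x y hx hy).
    apply is_RInt_fct_extend_fst, is_RInt_fct_extend_fst in hH; exact hH.
- apply (indefinite_integral_substitution a b theta kappa sigma
           (fun u => snd (fst (f u))) (fun s => snd (fst (H s))));
    [assumption .. | |].
  + intros s hs; apply (continuous_comp f (fun v : E13 => snd (fst v)));
      [apply hf, hs |].
    apply (linear_cont (fun v : E13 => snd (fst v))).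
    apply (is_linear_comp fst snd); [apply is_linear_fst | apply is_linear_snd].
  + intros x y hx hy; specialize (hH x y hx hy).
    apply is_RInt_fct_extend_fst, is_RInt_fct_extend_snd in hH; exact hH.
- apply (indefinite_integral_substitution a b theta kappa sigma
           (fun u => snd (f u)) (fun s => snd (H s)));
    [assumption .. | |].
  + intros s hs; apply (continuous_comp f (fun v : E13 => snd v));
      [apply hf, hs |].
    apply (linear_cont (fun v : E13 => snd v)), is_linear_snd.
  + intros x y hx hy; specialize (hH x y hx hy).
    apply is_RInt_fct_extend_snd in hH; exact hH.
Qed.

(** * The angle with the axis *)

Lemma spacelike_pos (d : E13) : d <> zero -> spacelike d -> 0 < g d d.
Proof. intros h0 [h | h]; [exact h | contradiction]. Qed.

Lemma spacelike_angle_cos_sq (X d : E13) (phi : R) :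
  g X X = 1 -> 0 < g d d -> spacelike_angle X d phi ->
  (g X d) ^ 2 = g d d * (cos phi) ^ 2.
Proof.
intros hX hd (_ & _ & _ & _ & h).
rewrite <- pow2_abs, h; unfold lnorm.
rewrite hX, Rabs_R1, sqrt_1, (Rabs_right (g d d)) by lra.
replace ((1 * sqrt (g d d) * cos phi) ^ 2)
  with ((sqrt (g d d) * sqrt (g d d)) * cos phi ^ 2) by ring.
rewrite sqrt_sqrt; lra.
Qed.

(** Strictness comes from the spacelike plane, which contains the nonzero
    component of [d] orthogonal to [X]. *)
Lemma spacelike_angle_cos_lt_1 (X d : E13) (phi : R) :
  g X X = 1 -> 0 < g d d -> spacelike_angle X d phi -> (cos phi) ^ 2 < 1.
Proof.
intros hX hd h.
assert (hsq := spacelike_angle_cos_sq X d phi hX hd h).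
destruct h as (_ & _ & [hfree hplane] & _ & _).
destruct (hplane (- g X d) 1) as [hp | hp].
- rewrite ?g_plus_l, ?g_plus_r, ?g_scal_l, ?g_scal_r, (g_sym d X), hX in hp.
  nra.
- destruct (hfree _ _ hp); lra.
Qed.

(** The sign of [k] is free, and is chosen to make the product with [X]
    nonnegative. *)
Lemma unit_axis_exists (X d : E13) (phi : R) :
  g X X = 1 -> 0 < g d d -> spacelike_angle X d phi ->
  exists k, k <> 0 /\ g (scal k d) (scal k d) = 1 /\ g X (scal k d) = cos phi.
Proof.
intros hX hd h.
assert (hs := sqrt_lt_R0 _ hd).
assert (hss : sqrt (g d d) * sqrt (g d d) = g d d) by (apply sqrt_sqrt; lra).
destruct h as (_ & _ & _ & _ & h); revert h; unfold lnorm.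
rewrite hX, Rabs_R1, sqrt_1, (Rabs_right (g d d)) by lra; intros h.
set (q := sqrt (g d d)) in *.
assert (sign : exists e, (e = 1 \/ e = -1) /\ Rabs (g X d) = e * g X d).
{ destruct (Rle_dec 0 (g X d)).
  - exists 1; rewrite Rabs_right; lra.
  - exists (-1); rewrite Rabs_left; lra. }
destruct sign as (e & he & ha).
exists (e / q); repeat split.
- intros h0; assert (h1 : e / q * q = e) by (field; lra).
  rewrite h0 in h1; lra.
- rewrite g_scal_l, g_scal_r, <- hss; destruct he as [-> | ->]; field; lra.
- rewrite g_scal_r; apply (Rmult_eq_reg_l q); [| lra].
  replace (q * (e / q * g X d)) with (e * g X d) by (field; lra).
  rewrite <- ha, h; ring.
Qed.

(** * The tangent of the helix *)

Lemma is_derive_constant_on (a b : Rbar) (f : R -> R) (c l s : R) :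
  (forall t, open_itv a b t -> f t = c) -> open_itv a b s ->
  is_derive f s l -> l = 0.
Proof.
intros hc hs hl.
rewrite <- (is_derive_unique f s l hl).
rewrite (Derive_ext_loc f (fun _ => c)); [apply Derive_const |].
apply (locally_open (open_itv a b)); [apply open_open_itv | exact hc | exact hs].
Qed.

Lemma is_derive_g (X : R -> E13) (dX v : E13) (s : R) :
  is_derive X s dX -> is_derive (fun t => g (X t) v) s (g dX v).
Proof. exact (is_derive_linear_comp (fun u => g u v) X s dX (is_linear_g v)). Qed.

(** The function in question is the second derivative of [l] composed with the
    curve. *)
Lemma curvature_normal_continuous (a b : Rbar) (psi T N : R -> E13)
    (kappa : R -> R) (l : E13 -> R) (s : R) :
  is_linear l ->
  (forall k t, open_itv a b t -> ex_derive_n (fun t => l (psi t)) k t) ->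
  (forall t, open_itv a b t -> is_derive psi t (T t)) ->
  (forall t, open_itv a b t -> is_derive T t (scal (kappa t) (N t))) ->
  open_itv a b s -> continuous (fun t => kappa t * l (N t)) s.
Proof.
intros hl hpsi hT hdT hs.
apply (continuous_ext_loc _ (Derive_n (fun t => l (psi t)) 2)).
- apply (locally_open (open_itv a b)); [apply open_open_itv | | exact hs].
  intros t ht; cbn.
  refine (eq_trans _ (linear_scal l hl (kappa t) (N t))).
  etransitivity; [| exact (is_derive_unique (fun u => l (T u)) t _
                      (is_derive_linear_comp l T t _ hl (hdT t ht)))].
  apply Derive_ext_loc.
  apply (locally_open (open_itv a b)); [apply open_open_itv | | exact ht].
  intros u hu; apply (is_derive_unique (fun t => l (psi t))).
  exact (is_derive_linear_comp l psi u _ hl (hT u hu)).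
- apply (ex_derive_continuous (Derive_n (fun t => l (psi t)) 2)).
  exact (hpsi 3%nat s hs).
Qed.

(** Since [g N N = -1], the curvature is [- g (kappa N) N], where [kappa N] is
    the second derivative of the curve. *)
Lemma curvature_continuous (a b : Rbar) (psi T N B : R -> E13) (kappa tau : R -> R)
    (s : R) :
  smooth (open_itv a b) psi ->
  frenet_frame (open_itv a b) psi T N B (-1) kappa tau ->
  open_itv a b s -> continuous kappa s.
Proof.
intros hsmooth hF hs.
assert (h1 : is_linear (fun u : E13 => fst (fst u)))
  by (apply (is_linear_comp fst fst); apply is_linear_fst).
assert (h2 : is_linear (fun u : E13 => snd (fst u)))
  by (apply (is_linear_comp fst snd); [apply is_linear_fst | apply is_linear_snd]).
assert (h3 : is_linear (fun u : E13 => snd u)) by apply is_linear_snd.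
assert (prod : forall l : E13 -> R, is_linear l ->
          (forall k t, open_itv a b t -> ex_derive_n (fun t => l (psi t)) k t) ->
          continuous (fun t => kappa t * l (N t) * l (N t)) s).
{ intros l hl hpsi.
  apply (continuous_mult (fun t => kappa t * l (N t)) (fun t => l (N t))).
  - apply (curvature_normal_continuous a b psi T N kappa l s hl hpsi);
      [apply (frenet_T _ _ _ _ _ _ _ _ hF) | apply (frenet_dT _ _ _ _ _ _ _ _ hF) | exact hs].
  - exact (is_derive_continuous (fun t => l (N t)) s _
      (is_derive_linear_comp l N s _ hl (frenet_dN _ _ _ _ _ _ _ _ hF s hs))). }
apply (continuous_ext_loc _ (fun t =>
  plus (kappa t * fst (fst (N t)) * fst (fst (N t)))
    (opp (plus (kappa t * snd (fst (N t)) * snd (fst (N t)))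
               (kappa t * snd (N t) * snd (N t)))))).
- apply (locally_open (open_itv a b)); [apply open_open_itv | | exact hs].
  intros t ht; assert (hNN := frenet_gNN _ _ _ _ _ _ _ _ hF t ht).
  destruct (N t) as [[n1 n2] n3]; E13_unfold.
  replace (kappa t) with (kappa t * - (- (n1 * n1) + n2 * n2 + n3 * n3)) at 4
    by (rewrite hNN; ring).
  ring.
- apply (continuous_plus (fun t => kappa t * fst (fst (N t)) * fst (fst (N t)))).
  + apply (prod _ h1); intros k t ht; apply (hsmooth k t ht).
  + apply (continuous_opp (fun t => plus (kappa t * snd (fst (N t)) * snd (fst (N t)))
               (kappa t * snd (N t) * snd (N t)))).
    apply (continuous_plus (fun t => kappa t * snd (fst (N t)) * snd (fst (N t)))).
    * apply (prod _ h2); intros k t ht; apply (hsmooth k t ht).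
    * apply (prod _ h3); intros k t ht; apply (hsmooth k t ht).
Qed.

Lemma exponential_growth (a b : Rbar) (z theta kappa : R -> R) (c s0 s : R) :
  (forall t, open_itv a b t -> is_derive theta t (kappa t)) ->
  (forall t, open_itv a b t -> is_derive z t (c * kappa t * z t)) ->
  open_itv a b s0 -> open_itv a b s -> theta s0 = 0 ->
  z s = z s0 * exp (c * theta s).
Proof.
intros ht hz h0 hs e0.
assert (hconst : z s * exp (- (c * theta s)) = z s0 * exp (- (c * theta s0))).
{ apply (derive_zero_constant a b (fun t => z t * exp (- (c * theta t))));
    [| assumption ..].
  intros t hti; auto_derive.
  - split; [eexists; apply hz, hti | split; [eexists; apply ht, hti | exact I]].
  - replace (Derive (fun t => z t) t) with (c * kappa t * z t) by
      (symmetry; apply is_derive_unique, hz, hti).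
    replace (Derive (fun t => theta t) t) with (kappa t) by
      (symmetry; apply is_derive_unique, ht, hti).
    ring. }
rewrite e0, Rmult_0_r, Ropp_0, exp_0, Rmult_1_r in hconst.
rewrite <- hconst, Rmult_assoc, <- exp_plus, Rplus_opp_l, exp_0; ring.
Qed.

(** The combinations [x + r * y] and [x - r * y] decouple the system. *)
Lemma hyperbolic_oscillator (a b : Rbar) (x y theta kappa : R -> R) (r s0 s : R) :
  0 < r ->
  (forall t, open_itv a b t -> is_derive theta t (kappa t)) ->
  (forall t, open_itv a b t -> is_derive x t (kappa t * y t)) ->
  (forall t, open_itv a b t -> is_derive y t (kappa t * x t / (r * r))) ->
  open_itv a b s0 -> open_itv a b s -> theta s0 = 0 ->
  x s = x s0 * cosh (/ r * theta s) + r * y s0 * sinh (/ r * theta s).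
Proof.
intros hr ht hx hy h0 hs e0.
assert (hplus := exponential_growth a b (fun t => x t + r * y t) theta kappa
                   (/ r) s0 s ht).
assert (hminus := exponential_growth a b (fun t => x t - r * y t) theta kappa
                    (- / r) s0 s ht).
cbv beta in hplus, hminus.
rewrite Ropp_mult_distr_l_reverse in hminus.
unfold cosh, sinh.
assert (ep : x s + r * y s = (x s0 + r * y s0) * exp (/ r * theta s)).
{ apply hplus; try assumption; intros t hti; auto_derive.
  - split; [eexists; apply hx, hti | split; [eexists; apply hy, hti | exact I]].
  - replace (Derive (fun t => x t) t) with (kappa t * y t) by
      (symmetry; apply is_derive_unique, hx, hti).
    replace (Derive (fun t => y t) t) with (kappa t * x t / (r * r)) by
      (symmetry; apply is_derive_unique, hy, hti).
    field; lra. }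
assert (em : x s - r * y s = (x s0 - r * y s0) * exp (- (/ r * theta s))).
{ apply hminus; try assumption; intros t hti; auto_derive.
  - split; [eexists; apply hx, hti | split; [eexists; apply hy, hti | exact I]].
  - replace (Derive (fun t => x t) t) with (kappa t * y t) by
      (symmetry; apply is_derive_unique, hx, hti).
    replace (Derive (fun t => y t) t) with (kappa t * x t / (r * r)) by
      (symmetry; apply is_derive_unique, hy, hti).
    field; lra. }
lra.
Qed.

(** Along the curve the axis has the constant coordinate [n] on [T] and no
    coordinate on [N].  Differentiating the latter gives
    [kappa * n + tau * g B D = 0], which eliminates the torsion from [N']. *)
Lemma axis_coordinates (a b : Rbar) (psi T N B : R -> E13) (kappa tau : R -> R)
    (D : E13) (n : R) (s : R) :
  frenet_frame (open_itv a b) psi T N B (-1) kappa tau ->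
  (forall t, open_itv a b t -> kappa t <> 0) ->
  g D D = 1 -> (forall t, open_itv a b t -> g (T t) D = n) ->
  open_itv a b s ->
  g (N s) D = 0 /\ kappa s * n + tau s * g (B s) D = 0 /\
  n * n + g (B s) D * g (B s) D = 1 /\
  D = plus (scal n (T s)) (scal (g (B s) D) (B s)).
Proof.
intros hF hk hD hT hs.
assert (hN : forall t, open_itv a b t -> g (N t) D = 0).
{ intros t ht.
  assert (h : g (scal (kappa t) (N t)) D = 0).
  { apply (is_derive_constant_on a b (fun t => g (T t) D) n _ t hT ht).
    apply is_derive_g, (frenet_dT _ _ _ _ _ _ _ _ hF t ht). }
  rewrite g_scal_l in h; apply Rmult_integral in h.
  destruct h as [h | h]; [exfalso; exact (hk t ht h) | exact h]. }
assert (hB : kappa s * n + tau s * g (B s) D = 0).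
{ rewrite <- (hT s hs).
  assert (h := is_derive_constant_on a b (fun t => g (N t) D) 0 _ s hN hs
                 (is_derive_g N _ D s (frenet_dN _ _ _ _ _ _ _ _ hF s hs))).
  rewrite g_plus_l, !g_scal_l in h; lra. }
assert (hframe : lorentz_orthonormal (N s) (T s) (B s)).
{ repeat split.
  - apply (frenet_gNN _ _ _ _ _ _ _ _ hF s hs).
  - apply (frenet_gTT _ _ _ _ _ _ _ _ hF s hs).
  - rewrite (frenet_gBB _ _ _ _ _ _ _ _ hF s hs); ring.
  - rewrite g_sym; apply (frenet_gTN _ _ _ _ _ _ _ _ hF s hs).
  - apply (frenet_gNB _ _ _ _ _ _ _ _ hF s hs).
  - apply (frenet_gTB _ _ _ _ _ _ _ _ hF s hs). }
assert (hexp : D = plus (scal n (T s)) (scal (g (B s) D) (B s))).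
{ rewrite (lorentz_orthonormal_expansion _ _ _ D hframe) at 1.
  rewrite (g_sym D (N s)), (g_sym D (T s)), (g_sym D (B s)).
  rewrite (hN s hs), (hT s hs), Ropp_0.
  exact (eq_trans (f_equal2 plus (scal_zero_l (N s)) eq_refl) (plus_zero_l _)). }
split; [apply hN, hs | split; [exact hB | split; [| exact hexp]]].
assert (h : g (plus (scal n (T s)) (scal (g (B s) D) (B s))) D = 1)
  by (rewrite <- hexp; exact hD).
rewrite g_plus_l, !g_scal_l, (hT s hs) in h; exact h.
Qed.

(** The equations are [P' = kappa N] and [N' = kappa / r ^ 2 P] for the component
    [P = T - n D] of the tangent orthogonal to the axis, tested against a fixed
    vector [v]; they close because the torsion is a multiple of the curvature. *)
Lemma tangent_solution (a b : Rbar) (psi T N B : R -> E13) (kappa tau theta : R -> R)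
    (D v : E13) (n r s0 s : R) :
  frenet_frame (open_itv a b) psi T N B (-1) kappa tau ->
  (forall t, open_itv a b t -> kappa t <> 0) ->
  g D D = 1 -> (forall t, open_itv a b t -> g (T t) D = n) ->
  0 < r -> r * r = 1 - n * n ->
  (forall t, open_itv a b t -> is_derive theta t (kappa t)) ->
  open_itv a b s0 -> open_itv a b s -> theta s0 = 0 ->
  g (T s) v - n * g D v =
    (g (T s0) v - n * g D v) * cosh (/ r * theta s)
    + r * g (N s0) v * sinh (/ r * theta s).
Proof.
intros hF hk hD hT hr hrr ht h0 hs e0.
apply (hyperbolic_oscillator a b (fun t => g (T t) v - n * g D v)
         (fun t => g (N t) v) theta kappa r s0 s hr ht); [| | assumption ..].
- intros t hti.
  assert (h := is_derive_minus (fun t => g (T t) v) (fun _ => n * g D v) t _ _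
    (is_derive_g T _ v t (frenet_dT _ _ _ _ _ _ _ _ hF t hti))
    (is_derive_const (n * g D v) t)).
  rewrite g_scal_l in h.
  refine (eq_ind _ (fun l => is_derive _ t l) h _ _).
  unfold minus, plus, opp, zero; cbn; ring.
- intros t hti.
  assert (h := is_derive_g N _ v t (frenet_dN _ _ _ _ _ _ _ _ hF t hti)).
  rewrite g_plus_l, !g_scal_l in h.
  destruct (axis_coordinates a b psi T N B kappa tau D n t hF hk hD hT hti)
    as (_ & hB & hnB & hexp).
  assert (hDv : g D v = n * g (T t) v + g (B t) D * g (B t) v)
    by (rewrite hexp at 1; rewrite g_plus_l, !g_scal_l; reflexivity).
  set (beta := g (B t) D) in *.
  replace (kappa t * (g (T t) v - n * g D v) / (r * r))
    with (- -1 * kappa t * g (T t) v + tau t * g (B t) v); [exact h |].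
  apply (Rmult_eq_reg_r (r * r)); [| nra].
  replace (kappa t * (g (T t) v - n * g D v) / (r * r) * (r * r))
    with (kappa t * (g (T t) v - n * g D v)) by (field; lra).
  assert (hbb : beta * beta = r * r) by lra.
  assert (htb : tau t * beta = - (kappa t * n)) by lra.
  rewrite hDv.
  replace ((- -1 * kappa t * g (T t) v + tau t * g (B t) v) * (r * r))
    with (kappa t * g (T t) v * (r * r) + (tau t * beta) * beta * g (B t) v)
    by (rewrite <- hbb; ring).
  rewrite htb, hrr; ring.
Qed.

Lemma continuous_E13 (f1 f2 f3 : R -> R) (u : R) :
  continuous f1 u -> continuous f2 u -> continuous f3 u ->
  continuous (fun t => (f1 t, f2 t, f3 t) : E13) u.
Proof.
intros h1 h2 h3.
apply (continuous_comp_2 (fun t => (f1 t, f2 t)) f3 pair u); [| exact h3 |].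
- apply (continuous_comp_2 f1 f2 pair u h1 h2).
  apply (continuous_ext (fun p => p)); [intros []; reflexivity | apply continuous_id].
- apply (continuous_ext (fun p => p)); [intros []; reflexivity | apply continuous_id].
Qed.

Lemma continuous_hyperbolic_dir (m u : R) : continuous (hyperbolic_dir m) u.
Proof.
unfold hyperbolic_dir.
apply continuous_E13; [| | apply continuous_const];
  unfold sinh, cosh; apply (ex_derive_continuous (V := R_NormedModule));
  auto_derive; exact I.
Qed.

Lemma sqrt_one_plus_ratio_sq (n r : R) :
  0 < r -> r * r = 1 - n * n -> sqrt (1 + (n / r) ^ 2) = / r.
Proof.
intros hr hrr.
replace (1 + (n / r) ^ 2) with ((/ r) ^ 2).
- apply sqrt_pow2, Rlt_le, Rinv_0_lt_compat, hr.
- field_simplify; [| lra | lra].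
  f_equal; nra.
Qed.

(** The frame whose coordinates define the isometry; [T0] and [N0] stand for the
    tangent and the normal at a base point. *)
Lemma axis_frame_orthonormal (T0 N0 D : E13) (n r : R) :
  g T0 T0 = 1 -> g N0 N0 = -1 -> g D D = 1 ->
  g T0 N0 = 0 -> g N0 D = 0 -> g T0 D = n ->
  0 < r -> r * r = 1 - n * n ->
  lorentz_orthonormal N0 (scal (/ r) (plus T0 (scal (- n) D))) D.
Proof.
intros hTT hNN hDD hTN hND hTD hr hrr.
repeat split; try assumption;
  rewrite ?g_scal_l, ?g_scal_r, ?g_plus_l, ?g_plus_r, ?g_scal_l, ?g_scal_r,
    ?(g_sym D T0), ?(g_sym N0 T0), ?hTT, ?hTN, ?hND, ?hTD, ?hDD; try ring.
replace (1 + - n * n + (- n * n + - n * (- n * 1))) with (r * r) by (rewrite hrr; ring).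
field; lra.
Qed.

(** Testing [tangent_solution] against the first two vectors of the frame gives
    the initial values of [- r * sinh] and [r * cosh]; the first coordinate is
    minus the product with [N s0], because [N s0] is timelike. *)
Lemma tangent_in_axis_frame (a b : Rbar) (psi T N B : R -> E13)
    (kappa tau theta : R -> R) (D : E13) (n r s0 s : R) :
  frenet_frame (open_itv a b) psi T N B (-1) kappa tau ->
  (forall t, open_itv a b t -> kappa t <> 0) ->
  g D D = 1 -> (forall t, open_itv a b t -> g (T t) D = n) ->
  0 < r -> r * r = 1 - n * n ->
  (forall t, open_itv a b t -> is_derive theta t (kappa t)) ->
  open_itv a b s0 -> open_itv a b s -> theta s0 = 0 ->
  frame_coords (N s0) (scal (/ r) (plus (T s0) (scal (- n) D))) D (T s)
  = scal r (hyperbolic_dir (n / r) (theta s)).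
Proof.
intros hF hk hD hT hr hrr ht h0 hs e0.
assert (hN0 : g (N s0) D = 0)
  by apply (axis_coordinates a b psi T N B kappa tau D n s0 hF hk hD hT h0).
assert (hTT := frenet_gTT _ _ _ _ _ _ _ _ hF s0 h0).
assert (hNN := frenet_gNN _ _ _ _ _ _ _ _ hF s0 h0).
assert (hTN := frenet_gTN _ _ _ _ _ _ _ _ hF s0 h0).
assert (hTD := hT s0 h0).
assert (sol := fun v => tangent_solution a b psi T N B kappa tau theta D v n r s0 s
                          hF hk hD hT hr hrr ht h0 hs e0).
unfold frame_coords, hyperbolic_dir.
rewrite (sqrt_one_plus_ratio_sq n r hr hrr).
transitivity (r * sinh (/ r * theta s), r * cosh (/ r * theta s), r * (n / r));
  [apply E13_eq | reflexivity].
- assert (h := sol (N s0)).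
  rewrite (g_sym D (N s0)), hN0, hTN, hNN in h; lra.
- assert (h := sol (scal (/ r) (plus (T s0) (scal (- n) D)))).
  assert (hDE : g D (scal (/ r) (plus (T s0) (scal (- n) D))) = 0)
    by (rewrite g_scal_r, g_plus_r, g_scal_r, (g_sym D (T s0)), hTD, hD; ring).
  assert (hNE : g (N s0) (scal (/ r) (plus (T s0) (scal (- n) D))) = 0)
    by (rewrite g_scal_r, g_plus_r, g_scal_r, (g_sym (N s0) (T s0)), hTN, hN0; ring).
  assert (hTE : g (T s0) (scal (/ r) (plus (T s0) (scal (- n) D))) = r).
  { rewrite g_scal_r, g_plus_r, g_scal_r, hTT, hTD.
    replace (1 + - n * n) with (r * r) by (rewrite hrr; ring).
    field; lra. }
  rewrite hDE, hNE, hTE in h; lra.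
- rewrite (hT s hs); field; lra.
Qed.

(** A nonzero product with the axis cannot change sign, and its square is
    prescribed by the angle. *)
Lemma axis_product_constant (a b : Rbar) (psi T N B : R -> E13) (eps : R)
    (kappa tau : R -> R) (d : E13) (phi k s0 : R) :
  frenet_frame (open_itv a b) psi T N B eps kappa tau ->
  0 < g d d ->
  (forall s, open_itv a b s -> spacelike_angle (T s) d phi) ->
  g (scal k d) (scal k d) = 1 -> open_itv a b s0 ->
  g (T s0) (scal k d) = cos phi ->
  forall s, open_itv a b s -> g (T s) (scal k d) = cos phi.
Proof.
intros hF hd hangle hk h0 e0.
assert (hsq : forall s, open_itv a b s -> g (T s) (scal k d) ^ 2 = cos phi ^ 2).
{ intros s hs.
  assert (h := spacelike_angle_cos_sq (T s) d phi
    (frenet_gTT _ _ _ _ _ _ _ _ hF s hs) hd (hangle s hs)).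
  rewrite g_scal_l, g_scal_r in hk; rewrite g_scal_r.
  replace ((k * g (T s) d) ^ 2) with (k * k * (g (T s) d) ^ 2) by ring.
  rewrite h; replace (k * k * (g d d * cos phi ^ 2))
    with ((k * (k * g d d)) * cos phi ^ 2) by ring.
  rewrite hk; ring. }
intros s hs.
destruct (Req_dec (cos phi) 0) as [hz | hz].
- assert (h := hsq s hs); rewrite hz in *; nra.
- assert (hsign := nonvanishing_same_sign a b (fun t => g (T t) (scal k d)) s0 s).
  cbv beta in hsign; rewrite e0 in hsign.
  assert (h := hsq s hs).
  assert (hpos : 0 < cos phi * g (T s) (scal k d)).
  { apply hsign; try assumption; intros t ht.
    - exact (is_derive_continuous _ _ _
        (is_derive_g T _ _ t (frenet_dT _ _ _ _ _ _ _ _ hF t ht))).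
    - intros hzt; assert (h' := hsq t ht); rewrite hzt in h'; nra. }
  assert (hfac : (g (T s) (scal k d) - cos phi) * (g (T s) (scal k d) + cos phi) = 0)
    by (ring_simplify; lra).
  apply Rmult_integral in hfac; destruct hfac as [hf | hf]; nra.
Qed.

Theorem theorem3p5
  (a b : Rbar) (hab : Rbar_lt a b)
  (psi T N B : R -> E13) (eps : R) (kappa tau : R -> R)
  (hsmooth : smooth (open_itv a b) psi)
  (hfrenet : frenet_frame (open_itv a b) psi T N B eps kappa tau)
  (hkappa : forall s, open_itv a b s -> kappa s <> 0)
  (hN : forall s, open_itv a b s -> timelike (N s))
  (p d : E13) (hd0 : d <> zero) (hd : spacelike d)
  (phi : R)
  (hangle : forall s, open_itv a b s -> spacelike_angle (T s) d phi) :
  let n := cos phi in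
  let m := n / sqrt (1 - n ^ 2) in
  exists F : E13 -> E13,
    lorentz_isometry F /\
    (forall q, line p d q <-> line (F p) e3 (F q)) /\
    exists theta : R -> R,
      indefinite_integral (open_itv a b) kappa theta /\
      (exists G : R -> E13,
        indefinite_integral (open_itv a b)
          (fun s => hyperbolic_dir m (theta s)) G /\
        forall s, open_itv a b s -> F (psi s) = scal (sqrt (1 - n ^ 2)) (G s)) /\
      (exists sigma : R -> R,
        (forall s, open_itv a b s -> sigma (theta s) = s) /\
        indefinite_integral
          (fun u => exists s, open_itv a b s /\ theta s = u)
          (fun u => scal (sqrt (1 - n ^ 2) / kappa (sigma u))
                      (hyperbolic_dir m u))
          (fun u => F (psi (sigma u)))).
Proof.
intros n m.
destruct (open_itv_nonempty a b hab) as [s0 h0].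
assert (heps : eps = -1).
{ assert (h := hN s0 h0); unfold timelike in h.
  rewrite (frenet_gNN _ _ _ _ _ _ _ _ hfrenet s0 h0) in h.
  destruct (frenet_eps _ _ _ _ _ _ _ _ hfrenet); lra. }
subst eps.
assert (hkc : forall s, open_itv a b s -> continuous kappa s)
  by (intros s; apply (curvature_continuous a b psi T N B kappa tau); assumption).
assert (hdd := spacelike_pos d hd0 hd).
assert (hTT0 := frenet_gTT _ _ _ _ _ _ _ _ hfrenet s0 h0).
assert (hn1 : n ^ 2 < 1)
  by exact (spacelike_angle_cos_lt_1 _ _ _ hTT0 hdd (hangle s0 h0)).
set (r := sqrt (1 - n ^ 2)) in *.
assert (hr : 0 < r) by (apply sqrt_lt_R0; lra).
assert (hrr : r * r = 1 - n * n) by (unfold r; rewrite sqrt_sqrt; lra).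
destruct (unit_axis_exists _ _ _ hTT0 hdd (hangle s0 h0)) as (k & hk & hDD & hTD0).
assert (hTD := axis_product_constant a b psi T N B (-1) kappa tau d phi k s0
                 hfrenet hdd hangle hDD h0 hTD0).
fold n in hTD, hTD0.
set (D := scal k d : E13) in *.
destruct (primitive_exists a b kappa s0 hkc h0) as (theta & e0 & htheta).
set (L := frame_coords (N s0) (scal (/ r) (plus (T s0) (scal (- n) D))) D).
assert (hL : lorentz_orthonormal (N s0) (scal (/ r) (plus (T s0) (scal (- n) D))) D).
{ apply (axis_frame_orthonormal _ _ _ n r); try assumption.
  - apply (frenet_gNN _ _ _ _ _ _ _ _ hfrenet s0 h0).
  - apply (frenet_gTN _ _ _ _ _ _ _ _ hfrenet s0 h0).
  - apply (axis_coordinates a b psi T N B kappa tau D n s0); assumption. }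
assert (hLlin : is_linear L) by apply is_linear_frame_coords.
assert (hLpsi : forall s, open_itv a b s ->
          is_derive (fun t => L (psi t)) s (scal r (hyperbolic_dir m (theta s)))).
{ intros s hs.
  assert (hLT := tangent_in_axis_frame a b psi T N B kappa tau theta D n r s0 s
    hfrenet hkappa hDD hTD hr hrr htheta h0 hs e0).
  fold m L in hLT; rewrite <- hLT.
  apply is_derive_linear_comp; [exact hLlin |].
  apply (frenet_T _ _ _ _ _ _ _ _ hfrenet s hs). }
assert (hthetac : forall s, open_itv a b s -> continuous theta s)
  by (intros s hs; exact (is_derive_continuous theta s (kappa s) (htheta s hs))).
assert (hhyp : forall s, open_itv a b s ->
          continuous (fun t => hyperbolic_dir m (theta t)) s)
  by (intros s hs; apply (continuous_comp theta);
      [apply hthetac, hs | apply continuous_hyperbolic_dir]).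
exists L; split; [| split].
- exists L, zero; split; [exact hLlin | split].
  + intros u v; apply frame_coords_isometry, hL.
  + intros x; symmetry; apply plus_zero_r.
- intros q; apply (frame_coords_line _ _ _ p d q k hL hk); reflexivity.
- exists theta; split; [| split].
  + apply indefinite_integral_of_derive; assumption.
  + exists (fun s => scal (/ r) (L (psi s))); split.
    * apply indefinite_integral_of_derive_E13; [| exact hhyp].
      intros s hs.
      refine (eq_ind _ (fun l => is_derive _ s l)
        (is_derive_linear_comp (fun u : E13 => scal (/ r) u) _ s _ _ (hLpsi s hs)) _ _).
      -- apply is_linear_E13_scal.
      -- rewrite E13_scal_scal, Rinv_l by lra; apply E13_scal_1.
    * intros s hs; rewrite E13_scal_scal, Rinv_r by lra.
      symmetry; apply E13_scal_1.
  + destruct (left_inverse_exists (open_itv a b) theta) as [sigma hsigma].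
    { intros x y; apply (nonzero_derive_inj a b theta kappa); assumption. }
    exists sigma; split; [exact hsigma |].
    apply (indefinite_integral_substitution_E13 a b theta kappa sigma
             (fun u => scal (r / kappa (sigma u)) (hyperbolic_dir m u))
             (fun s => L (psi s))); try assumption.
    * intros s hs.
      apply (continuous_E13_scal (fun u => r / kappa (sigma u)) (hyperbolic_dir m));
        [| apply continuous_hyperbolic_dir].
      apply (continuous_mult (fun _ => r) (fun u => / kappa (sigma u)));
        [apply continuous_const |].
      apply (continuous_Rinv_comp (fun u => kappa (sigma u)));
        rewrite ?(hsigma s hs); [| apply hkappa, hs].
      apply (continuous_comp sigma kappa); rewrite ?(hsigma s hs);
        [| apply hkc, hs].
      apply (left_inverse_continuous a b theta kappa); assumption.
    * intros x y hx hy.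
      apply (is_RInt_ext (fun s => scal r (hyperbolic_dir m (theta s)))).
      -- intros s hs.
         assert (hsI : open_itv a b s)
           by (apply (open_itv_between a b x y); [assumption .. | lra]).
         rewrite (hsigma s hsI), E13_scal_scal; f_equal.
         field; apply hkappa, hsI.
      -- revert x y hx hy; apply indefinite_integral_of_derive_E13; [exact hLpsi |].
         intros s hs.
         apply (continuous_E13_scal (fun _ => r) (fun t => hyperbolic_dir m (theta t)));
           [apply continuous_const | apply hhyp, hs].
Qed.
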